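(* Let $\eta,\beta,\epsilon,\alpha_p$ be real numbers, $r_c$ a positive integer, and let $k_{\bar x}:=\eta+\sqrt{2\eta^2+\bar\nu}$. Assume one of the following: (a) $\beta=0.20$, $\epsilon=0.50$, $r_c=1$, $\eta=\beta\epsilon^{r_c}$, and $\alpha_p=0.020\,k_{\bar x}^{-1}$; or (b) $\beta=0.25$, $\epsilon=0.70$, $r_c=2$, $\eta=\beta\epsilon^{r_c}$, and $\alpha_p=0.025\,k_{\bar x}^{-1}$. If $z\in\mathcal{N}(\eta)$, then the predictor phase with step length $\alpha_p$ applied to $z$ yields a point $z^+$ that satisfies $z^+\in\mathcal{N}(\beta)$. That is, if $z=(\bar x;y;\bar s)\in\mathcal{N}(\eta)$, $\Delta_z=(\Delta_{\bar x};\Delta_y;\Delta_{\bar s})$ is the solution of the predictor system at $z$, and $z^+:=z+\alpha_p\Delta_z$, then $z^+\in\mathcal{N}(\beta)$.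
   Context: Setting. $\langle\cdot,\cdot\rangle$ is the standard inner product and $\|\cdot\|$ the Euclidean norm. $K\subset\mathbb{R}^n$ is a proper cone (closed, convex, pointed, full-dimensional), $K^*=\{s\in\mathbb{R}^n:\langle x,s\rangle\ge 0\ \forall x\in K\}$ its dual cone, and $C^\circ$ denotes the interior of a set $C$. $A$ is an $m\times n$ real matrix of full row rank, $b\in\mathbb{R}^m$, $c\in\mathbb{R}^n$. Self-concordance and barriers. Let $F:K^\circ\to\mathbb{R}$ be twice continuously differentiable with gradient $g(x)$ and positive definite Hessian $H(x)$ for all $x\in K^\circ$. Put $\|u\|_x:=\|H(x)^{1/2}u\|$, $\|u\|_x^*:=\|H(x)^{-1/2}u\|$, $B_x(u,r):=\{v\in\mathbb{R}^n:\|v-u\|_x<r\}$. $F$ is self-concordant if for all $x\in K^\circ$ one has $B_x(x,1)\subset K^\circ$, and for all $u\in B_x(x,1)$ and $v\ne0$, $1-\|u-x\|_x\le\|v\|_u/\|v\|_x\le 1/(1-\|u-x\|_x)$. A self-concordant $F$ is a logarithmically homogeneous barrier with parameter $\nu$ if $\nu:=\sup_{x\in K^\circ}(\|g(x)\|_x^* )^2<\infty$ and $F(tx)=F(x)-\nu\ln t$ for all $x\in K^\circ$, $t>0$. Fix such an $F$ with parameter $\nu$. Extended objects. $\bar x:=(x;\tau)$, $\bar s:=(s;\kappa)$, $z:=(\bar x;y;\bar s)$, $\bar K:=K\times\mathbb{R}_+$, $\bar K^*:=K^*\times\mathbb{R}_+$, $\mathcal{F}:=\bar K\times\mathbb{R}^m\times\bar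 K^*$. $\bar F(\bar x):=F(x)-\log\tau$ on $\bar K^\circ$ has gradient $\bar g(\bar x)$ and Hessian $\bar H(\bar x)$; it is a logarithmically homogeneous barrier with parameter $\bar\nu:=\nu+1$ (and $\bar\nu\ge2$). For $\bar x\in\bar K^\circ$, $\|u\|_{\bar x}:=\|\bar H(\bar x)^{1/2}u\|$ and $\|u\|_{\bar x}^*:=\|\bar H(\bar x)^{-1/2}u\|$. $G:=\begin{pmatrix}0&A&-b\\ -A^\top&0&c\\ b^\top&-c^\top&0\end{pmatrix}$. $\mu(z):=\bar x^\top\bar s/\bar\nu$. $\psi(\bar x,\bar s,t):=\bar s+t\,\bar g(\bar x)$, and $\psi(z):=\psi(\bar x,\bar s,\mu(z))$. For $\theta\in[0,1]$, $\mathcal{N}(\theta):=\{z=(\bar x;y;\bar s)\in\mathcal{F}^\circ:\|\psi(z)\|_{\bar x}^*\le\theta\mu(z)\}$. Predictor system at $z=(\bar x;y;\bar s)\in\mathcal{F}^\circ$, with unknowns $\Delta_z=(\Delta_{\bar x};\Delta_y;\Delta_{\bar s})\in\mathbb{R}^{n+1}\times\mathbb{R}^m\times\mathbb{R}^{n+1}$: $G(\Delta_y;\Delta_{\bar x})-(0;\Delta_{\bar s})=-(G(y;\bar x)-(0;\bar s))$ and $\Delta_{\bar s}+\mu(z)\bar H(\bar x)\Delta_{\bar x}=-\bar s$. The predictor phase with step length $\alpha_p$ replaces $z$ by $z+\alpha_p\Delta_z$. (The parameters $\epsilon,r_c$ enter only through $\eta=\beta\epsilon^{r_c}$.) *)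

(* Defs.v *)
From HB Require Import structures.
From mathcomp Require Import all_boot all_order all_algebra.
From mathcomp Require Import all_classical all_reals all_analysis.
Set Implicit Arguments.
Unset Strict Implicit.
Unset Printing Implicit Defensive.
Import Order.TTheory GRing.Theory Num.Theory numFieldNormedType.Exports.
Local Open Scope classical_set_scope.
Local Open Scope ring_scope.

(* The topology on 'cV[R]_k is the library's sup-norm topology, which is the
   Euclidean one; the Euclidean norm itself is [enorm] below. *)

Section Euclidean.
Variables (R : realType) (k : nat).
Implicit Types (u v : 'cV[R]_k) (M S : 'M[R]_k) (f : 'cV[R]_k -> R).

Definition dotv u v : R := (u^T *m v) 0 0.

Definition enorm u : R := Num.sqrt (dotv u u).

Definition posdefmx M : Prop :=
  M^T = M /\ forall u, u != 0 -> 0 < dotv u (M *m u).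

(* M^(1/2): the unique positive definite square root of a positive definite
   matrix M; it is 0 when M has none. *)
Definition sqrtmx M : 'M[R]_k := xget 0 [set S | posdefmx S /\ S *m S = M].

Definition grad f (x : 'cV[R]_k) : 'cV[R]_k :=
  \col_i 'D_(delta_mx i 0) f x.

Definition hess f (x : 'cV[R]_k) : 'M[R]_k :=
  \matrix_(i, j) 'D_(delta_mx j 0) (fun y => grad f y i 0) x.

Definition lnorm f x u : R := enorm (sqrtmx (hess f x) *m u).

Definition dual_lnorm f x u : R := enorm (invmx (sqrtmx (hess f x)) *m u).

Definition lball f x u (r : R) : set 'cV[R]_k := [set v | lnorm f x (v - u) < r].

End Euclidean.

Section Barrier.
Variables (R : realType) (n : nat).
Implicit Types (K : set 'cV[R]_n) (F : 'cV[R]_n -> R).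

Record proper_cone K : Prop := ProperCone {
  pcone_scale : forall (t : R) x, 0 <= t -> K x -> K (t *: x) ;
  pcone_closed : closed K ;
  pcone_convex : convex_set K ;
  pcone_pointed : forall x, K x -> K (- x) -> x = 0 ;
  pcone_full : K° !=set0 }.

Definition dual_cone K : set 'cV[R]_n :=
  [set s | forall x, K x -> 0 <= dotv x s].

(* A function on the interior of K is represented by a total function on R^n
   of which only the restriction to the interior of K matters. *)
Definition C2_posdef K F : Prop :=
  forall x, K° x ->
    [/\ differentiable F x, differentiable (grad F) x,
        {for x, continuous (hess F)} & posdefmx (hess F x)].

Definition self_concordant K F : Prop :=
  forall x, K° x ->
    lball F x x 1 `<=` K° /\
    forall u v, lball F x x 1 u -> v != 0 ->
      1 - lnorm F x (u - x) <= lnorm F u v / lnorm F x v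
      /\ lnorm F u v / lnorm F x v <= 1 / (1 - lnorm F x (u - x)).

(* The real supremum [sup] is only meaningful for bounded sets, whence the
   separate finiteness clause. *)
Record lh_barrier K F (nu : R) : Prop := LHBarrier {
  lhb_C2 : C2_posdef K F ;
  lhb_sc : self_concordant K F ;
  lhb_bounded : has_ubound [set dual_lnorm F x (grad F x) ^+ 2 | x in K°] ;
  lhb_param : nu = sup [set dual_lnorm F x (grad F x) ^+ 2 | x in K°] ;
  lhb_loghom : forall x (t : R), K° x -> 0 < t ->
    F (t *: x) = F x - nu * ln t }.

End Barrier.

Section Extended.
Variables (R : realType) (n m : nat).
Implicit Types (K : set 'cV[R]_n) (F : 'cV[R]_n -> R).
Implicit Types (A : 'M[R]_(m, n)) (b : 'cV[R]_m) (c : 'cV[R]_n).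

Local Notation ext := 'cV[R]_(n + 1).

(* z = (xbar; y; sbar), with xbar = (x; tau) and sbar = (s; kappa). *)
Implicit Types (z D : (ext * 'cV[R]_m * ext)%type).

Definition xbar z : ext := z.1.1.
Definition yvec z : 'cV[R]_m := z.1.2.
Definition sbar z : ext := z.2.

(* K x R_+ *)
Definition bar_cone K : set ext :=
  [set xb | K (usubmx xb) /\ 0 <= dsubmx xb 0 0].

Definition feas_region K : set (ext * 'cV[R]_m * ext) :=
  [set z | bar_cone K (xbar z) /\ bar_cone (dual_cone K) (sbar z)].

Definition bar_fun F (xb : ext) : R := F (usubmx xb) - ln (dsubmx xb 0 0).

Definition nubar (nu : R) : R := nu + 1.

Definition mu (nu : R) z : R := dotv (xbar z) (sbar z) / nubar nu.

Definition psi F (xb sb : ext) (t : R) : ext := sb + t *: grad (bar_fun F) xb.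

Definition psiz F (nu : R) z : ext := psi F (xbar z) (sbar z) (mu nu z).

Definition nbhd K F (nu theta : R) : set (ext * 'cV[R]_m * ext) :=
  [set z | (feas_region K)° z /\
    dual_lnorm (bar_fun F) (xbar z) (psiz F nu z) <= theta * mu nu z].

Definition Gmx A b c : 'M[R]_(m + (n + 1)) :=
  block_mx 0                     (row_mx A (- b))
           (col_mx (- A^T) b^T)  (block_mx 0 c (- c^T) 0).

Definition residual A b c z : 'cV[R]_(m + (n + 1)) :=
  Gmx A b c *m col_mx (yvec z) (xbar z) - col_mx 0 (sbar z).

Definition predictor_system A b c F (nu : R) z D : Prop :=
  residual A b c D = - residual A b c z /\
  sbar D + mu nu z *: (hess (bar_fun F) (xbar z) *m xbar D) = - sbar z.

End Extended.

(* Main.v *)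
Require Import Defs.
From HB Require Import structures.
From mathcomp Require Import all_boot all_order all_algebra ring lra.
From mathcomp Require Import all_classical all_reals all_analysis.
Import Order.TTheory GRing.Theory Num.Theory numFieldNormedType.Exports.
Local Open Scope classical_set_scope.
Local Open Scope ring_scope.
Set Implicit Arguments.
Unset Strict Implicit.
Unset Printing Implicit Defensive.

(** Write [x], [s], [g], [H] for the extended primal point, dual point, gradient
    and Hessian, [|v|_x] for the norm of [H x], and [dx], [ds] for the predictor
    direction.

    The matrix [G] is skew-symmetric and [z + Delta] solves the homogeneous
    system, so [<x + dx, s + ds> = 0].  Since [s + ds = - mu H dx], this says
    [<x + dx, H dx> = 0], that is [|dx|_x ^ 2 = - <x, dx>_x], and therefore
    [|dx|_x <= |x|_x = sqrt nubar] ([predictor_direction_le]).  As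
    [k_xbar >= sqrt nubar], the step moves [x] by at most [a = 0.020] (or
    [a = 0.025]) in its own local norm, whatever the dimension; the new point
    stays in the Dikin ball, hence in the interior of the cone, and local norms
    change by a factor at most [1 / (1 - a)].

    With [psi = s + mu g x] the same orthogonality gives the exact value
    [mu' = (1 - alpha) mu (1 + delta)], where
    [delta = alpha <dx, psi> / (nubar mu)] is tiny, and
    [[
      psi' = (1 - alpha) psi + (1 - alpha) mu (g x' - g x)
             - alpha mu H dx + (1 - alpha) mu delta (g x').
    ]]
    The four terms are bounded by the hypothesis on [psi], by the mean value
    theorem ([grad_lipschitz]), by [|dx|_x <= sqrt nubar], and by
    [|g x'|* = sqrt nubar].  In both parameter settings the total is below
    [mu' / 5], which is at most [beta mu'] ([predictor_step]).

    It remains that [s'] is interior to the dual cone.  Every [u] in the cone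
    satisfies [- <g x', u> >= |u|_x' / 4] ([grad_ray_quarter]), so the pairing of
    [s'] with [u] is at least [(1/4 - 1/5) mu' |u|_x'], and the margin left
    between [1/5] and [1/4] covers a whole neighbourhood of [s'].

    These estimates use only the properties collected in [barrier_geometry].
    They hold for [F] ([barrier_geometry_lhb]) and pass to [F - log tau]
    ([barrier_geometry_ext]). *)

(** * Inner product and norms of positive definite matrices *)

Section LocalNorm.
Variables (R : realType) (k : nat).
Implicit Types (u v w : 'cV[R]_k) (M S : 'M[R]_k).

Lemma dotvE u v : dotv u v = \sum_i u i 0 * v i 0.
Proof. by rewrite /dotv mxE; apply: eq_bigr => i _; rewrite mxE. Qed.

Lemma dotvC u v : dotv u v = dotv v u.
Proof. by rewrite !dotvE; apply: eq_bigr => i _; rewrite mulrC. Qed.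

Lemma dotvDl u v w : dotv (u + v) w = dotv u w + dotv v w.
Proof. by rewrite /dotv raddfD mulmxDl mxE. Qed.

Lemma dotvZl a u w : dotv (a *: u) w = a * dotv u w.
Proof. by rewrite /dotv linearZ -scalemxAl mxE. Qed.

Lemma dotvNl u w : dotv (- u) w = - dotv u w.
Proof. by rewrite -scaleN1r dotvZl mulN1r. Qed.

Lemma dotvDr u v w : dotv w (u + v) = dotv w u + dotv w v.
Proof. by rewrite !(dotvC w) dotvDl. Qed.

Lemma dotvZr a u w : dotv w (a *: u) = a * dotv w u.
Proof. by rewrite !(dotvC w) dotvZl. Qed.

Lemma dotvNr u w : dotv w (- u) = - dotv w u.
Proof. by rewrite !(dotvC w) dotvNl. Qed.

Definition dotv_lin := (dotvDl, dotvDr, dotvNl, dotvNr, dotvZl, dotvZr).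

Lemma dotv_mulmx M u v : dotv (M *m u) v = dotv u (M^T *m v).
Proof. by rewrite /dotv trmx_mul mulmxA. Qed.

Lemma dotv_ge0 u : 0 <= dotv u u.
Proof. by rewrite dotvE sumr_ge0 // => i _; rewrite -expr2 sqr_ge0. Qed.

Lemma dotv_eq0 u : dotv u u = 0 -> u = 0.
Proof.
rewrite dotvE => /eqP; rewrite psumr_eq0; last first.
  by move=> i _; rewrite -expr2 sqr_ge0.
move=> /allP h; apply/matrixP => i j; rewrite ord1 mxE.
by have := h i (mem_index_enum i); rewrite /= mulf_eq0 orbb => /eqP.
Qed.

Lemma enorm_ge0 u : 0 <= enorm u. Proof. exact: sqrtr_ge0. Qed.

Lemma enorm_sqr u : enorm u ^+ 2 = dotv u u.
Proof. by rewrite sqr_sqrtr // dotv_ge0. Qed.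

Lemma enorm_eq0 u : enorm u = 0 -> u = 0.
Proof. by move=> h; apply: dotv_eq0; rewrite -enorm_sqr h expr0n. Qed.

(** Cauchy-Schwarz inequality. *)
Lemma dotv_le_enorm u v : dotv u v <= enorm u * enorm v.
Proof.
have [u0|u0] := eqVneq (enorm u) 0.
  by rewrite u0 mul0r (enorm_eq0 u0) /dotv trmx0 mul0mx mxE.
have [v0|v0] := eqVneq (enorm v) 0.
  by rewrite v0 mulr0 (enorm_eq0 v0) /dotv mulmx0 mxE.
have up : 0 < enorm u by rewrite lt_neqAle eq_sym u0 enorm_ge0.
have vp : 0 < enorm v by rewrite lt_neqAle eq_sym v0 enorm_ge0.
(* the usual square, scaled so that no division occurs *)
have := dotv_ge0 (enorm v *: u - enorm u *: v).
rewrite !dotv_lin (dotvC v u) -!enorm_sqr.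
set a := enorm u in up *; set b := enorm v in vp *; set d := dotv u v => h.
have h2 : 0 <= (2 * (a * b)) * (a * b - d) by nra.
by rewrite -subr_ge0 -(pmulr_rge0 _ (mulr_gt0 (ltr0n _ 2) (mulr_gt0 up vp))).
Qed.

(** The norm attached to a positive definite matrix, written without its
    square root: it is this quadratic form that enters all estimates, whereas
    square roots are awkward to differentiate and to split into blocks. *)
Definition hnorm M u : R := Num.sqrt (dotv u (M *m u)).

Lemma hnorm_ge0 M u : 0 <= hnorm M u. Proof. exact: sqrtr_ge0. Qed.

Definition has_root M := exists S, posdefmx S /\ S *m S = M.

Lemma root_dotv S u v : posdefmx S ->
  dotv u (S *m S *m v) = dotv (S *m u) (S *m v).
Proof. by case=> sS _; rewrite -mulmxA dotv_mulmx sS. Qed.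

Lemma root_hnorm S u : posdefmx S -> hnorm (S *m S) u = enorm (S *m u).
Proof. by move=> pS; rewrite /hnorm root_dotv. Qed.

Lemma posdefmx_unit S : posdefmx S -> S \in unitmx.
Proof.
case=> sS pS; rewrite unitmxE unitfE; apply/negP => /det0P [v v0 vS].
have vT0 : v^T != 0 by rewrite -trmx0 (inj_eq (can_inj (@trmxK _ _ _))).
have := pS _ vT0; rewrite -[S]sS -trmx_mul vS trmx0.
by rewrite /dotv mulmx0 mxE ltxx.
Qed.

Lemma hnorm_dot M u v : has_root M ->
  dotv (M *m u) v <= hnorm M u * hnorm M v.
Proof.
move=> [S [pS <-]]; rewrite !root_hnorm // dotvC root_dotv // dotvC.
exact: dotv_le_enorm.
Qed.

Lemma hnormZ M a u : hnorm M (a *: u) = `|a| * hnorm M u.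
Proof.
rewrite /hnorm -scalemxAr !dotv_lin mulrA -expr2 sqrtrM ?sqr_ge0 //.
by rewrite sqrtr_sqr.
Qed.

Lemma hnormN M u : hnorm M (- u) = hnorm M u.
Proof. by rewrite -scaleN1r hnormZ normrN1 mul1r. Qed.

Lemma hnorm0 M : hnorm M 0 = 0.
Proof. by rewrite /hnorm mulmx0 /dotv mulmx0 mxE sqrtr0. Qed.

Lemma hnorm_sqr M u : has_root M -> hnorm M u ^+ 2 = dotv u (M *m u).
Proof.
by move=> [S [pS <-]]; rewrite root_hnorm // enorm_sqr root_dotv.
Qed.

Lemma hnorm_gt0 M u : has_root M -> u != 0 -> 0 < hnorm M u.
Proof.
move=> [S [pS <-]] u0; rewrite root_hnorm // lt_neqAle enorm_ge0 andbT eq_sym.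
apply: contra u0 => /eqP/enorm_eq0 /(congr1 (mulmx (invmx S))).
by rewrite mulKmx ?posdefmx_unit // mulmx0 => ->.
Qed.

(** A dual norm bound amounts to the inequality obtained by pairing with an
    arbitrary direction; in this form bounds add up and survive a change of
    base point without any inverse matrix. *)
Lemma root_dual_le S w c : posdefmx S -> 0 <= c ->
  (forall v, dotv w v <= c * hnorm (S *m S) v) <->
  enorm (invmx S *m w) <= c.
Proof.
move=> pS c0; have uS := posdefmx_unit pS.
have pairE v : dotv w v = dotv (invmx S *m w) (S *m v).
  by case: (pS) => sS _; rewrite -{2}sS -dotv_mulmx mulKVmx.
split=> [h|h v].
  (* equality in Cauchy-Schwarz: [v] is the inverse of [S ^ 2] applied to [w] *)
  have := h (invmx S *m (invmx S *m w)).
  rewrite pairE root_hnorm // mulKVmx // -enorm_sqr expr2.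
  have [->|d0] := eqVneq (enorm (invmx S *m w)) 0; first by [].
  by rewrite ler_pM2r // lt_neqAle eq_sym d0 enorm_ge0.
rewrite pairE root_hnorm //; apply: le_trans (dotv_le_enorm _ _) _.
by rewrite ler_wpM2r // enorm_ge0.
Qed.

Lemma sqrtmxP M : has_root M -> posdefmx (sqrtmx M) /\ sqrtmx M *m sqrtmx M = M.
Proof.
move=> h; rewrite /sqrtmx.
by case: (xgetP (0 : 'M[R]_k) [set S | posdefmx S /\ S *m S = M]) => [//|/= /(_ _)];
  case: h => S hS /(_ S).
Qed.

Lemma lnormE (f : 'cV[R]_k -> R) x u : has_root (hess f x) ->
  lnorm f x u = hnorm (hess f x) u.
Proof. by move=> /sqrtmxP [pS e]; rewrite /lnorm -[in RHS]e root_hnorm. Qed.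

(** The first form of the dual norm bound enters the neighbourhoods; all
    computations use the second. *)
Lemma dual_lnorm_le (f : 'cV[R]_k -> R) x w c : has_root (hess f x) -> 0 <= c ->
  dual_lnorm f x w <= c <-> (forall v, dotv w v <= c * hnorm (hess f x) v).
Proof.
move=> /sqrtmxP [pS e] c0; have := root_dual_le w pS c0; rewrite e => h.
exact: iff_sym.
Qed.

End LocalNorm.

(** * Consequences of self-concordance and logarithmic homogeneity *)

Lemma mvt_closed (R : realType) (f df : R -> R) (a b : R) : a < b ->
  (forall x, a <= x <= b -> is_derive x 1 f (df x)) ->
  exists2 c, a <= c <= b & f b - f a = df c * (b - a).
Proof.
move=> ab h.
have dcc x : x \in `]a, b[%R -> is_derive x 1 f (df x).
  by rewrite in_itv /= => /andP[ac cb]; apply: h; rewrite !ltW.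
have cont : {within `[a, b], continuous f}.
  apply: derivable_within_continuous => x; rewrite in_itv /= => xab.
  by have [] := h _ xab.
have [c + fE] := MVT ab dcc cont.
by rewrite in_itv /= => /andP[ac cb]; exists c; rewrite ?ltW.
Qed.

Section Geometry.
Variables (R : realType) (k : nat).
Implicit Types (u v w x : 'cV[R]_k).

(** What the analysis of a predictor step needs from a barrier.  Norms are those
    of [hnorm], and differentiability is only required along lines: in this form
    the properties can be checked block by block for a sum of barriers in
    separate variables. *)
Record barrier_geometry (D : set 'cV[R]_k) (g : 'cV[R]_k -> 'cV[R]_k)
    (H : 'cV[R]_k -> 'M[R]_k) (nu : R) : Prop := BarrierGeometry {
  bg_root : forall x, D x -> has_root (H x) ;
  bg_deriv : forall x u w, D x ->
    is_derive (0 : R) (1 : R) (fun t : R => dotv (g (x + t *: u)) w)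
      (dotv (H x *m u) w) ;
  bg_dikin : forall x v, D x -> hnorm (H x) (v - x) < 1 -> D v ;
  bg_sc : forall x v w, D x -> hnorm (H x) (v - x) < 1 ->
    (1 - hnorm (H x) (v - x)) * hnorm (H x) w <= hnorm (H v) w /\
    (1 - hnorm (H x) (v - x)) * hnorm (H v) w <= hnorm (H x) w ;
  bg_hom : forall x, D x -> H x *m x = - g x ;
  bg_param : forall x, D x -> dotv x (g x) = - nu }.

Variables (D : set 'cV[R]_k) (g : 'cV[R]_k -> 'cV[R]_k).
Variables (H : 'cV[R]_k -> 'M[R]_k) (nu : R).
Hypothesis bg : barrier_geometry D g H nu.

Local Notation N x := (hnorm (H x)).

Lemma hnorm_point x : D x -> N x x ^+ 2 = nu.
Proof.
move=> Dx; rewrite (hnorm_sqr _ (bg_root bg Dx)) (bg_hom bg Dx) dotvNr.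
by rewrite (bg_param bg Dx) opprK.
Qed.

Lemma hnorm_point_sqrt x : D x -> N x x = Num.sqrt nu.
Proof.
by move=> Dx; rewrite -(hnorm_point Dx) sqrtr_sqr ger0_norm // hnorm_ge0.
Qed.

Lemma param_ge0 x : D x -> 0 <= nu.
Proof. by move=> Dx; rewrite -(hnorm_point Dx) sqr_ge0. Qed.

(** The dual norm of the gradient is [sqrt nu], because [g x = - H x *m x]. *)
Lemma grad_le x w : D x -> dotv (g x) w <= Num.sqrt nu * N x w.
Proof.
move=> Dx; have := hnorm_dot (- x) w (bg_root bg Dx).
by rewrite mulmxN (bg_hom bg Dx) opprK hnormN (hnorm_point_sqrt Dx).
Qed.

Lemma grad_ge x w : D x -> - (Num.sqrt nu * N x w) <= dotv (g x) w.
Proof.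
move=> Dx; have := grad_le (- w) Dx.
by rewrite dotvNr hnormN lerNl.
Qed.

Lemma line_derive x u w t : D (x + t *: u) ->
  is_derive t (1 : R) (fun s : R => dotv (g (x + s *: u)) w)
    (dotv (H (x + t *: u) *m u) w).
Proof.
move=> Dt; pose y := x + t *: u.
have d1 : is_derive t (1 : R) (fun s : R => s - t) 1.
  exact: is_derive_shift.
have d2 : is_derive (t - t) (1 : R) (fun s : R => dotv (g (y + s *: u)) w)
    (dotv (H y *m u) w) by rewrite subrr; apply: (bg_deriv bg u w Dt).
have := @is_derive1_comp _ _ (fun s => s - t) _ _ _ d2 d1; rewrite mulr1.
by congr (is_derive _ _ _ _); apply/funext => s /=;
  rewrite /y -addrA -scalerDl (addrC t) subrK.
Qed.

(** Mean value theorem along the segment: the Hessian metric at each of its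
    points exceeds the one at [x] by at most the factor [(1 - a)^-2]. *)
Lemma grad_lipschitz x d w : D x -> N x d < 1 ->
  dotv (g (x + d) - g x) w <= N x d / (1 - N x d) ^+ 2 * N x w.
Proof.
move=> Dx; set a := N x d => a1; have a0 : 0 <= a := hnorm_ge0 _ _.
have step t : 0 <= t <= 1 -> N x (x + t *: d - x) <= a.
  move=> /andP[t0 t1]; rewrite addrC addKr hnormZ ger0_norm //.
  by rewrite -[leRHS]mul1r ler_wpM2r.
have Dt t : 0 <= t <= 1 -> D (x + t *: d).
  by move=> t01; apply: (bg_dikin bg Dx); apply: le_lt_trans (step t t01) a1.
have [c c01] := mvt_closed (@ltr01 R) (fun t t01 => line_derive w (Dt t t01)).
rewrite subr0 mulr1 scale1r scale0r addr0 dotvDl dotvNl => ->.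
apply: le_trans (hnorm_dot _ _ (bg_root bg (Dt c c01))) _.
have r1 := le_lt_trans (step c c01) a1.
have bnd v : N (x + c *: d) v <= N x v / (1 - a).
  rewrite ler_pdivlMr ?subr_gt0 // mulrC.
  apply: le_trans (proj2 (bg_sc bg v Dx r1)).
  by rewrite ler_wpM2r ?hnorm_ge0 // lerD2l lerN2 step.
apply: le_trans (ler_pM (hnorm_ge0 _ _) (hnorm_ge0 _ _) (bnd d) (bnd w)) _.
by rewrite expr2 invfM !mulrA le_eqVlt; apply/orP; left; apply/eqP; rewrite -/a; ring.
Qed.

(** Along a ray [x + t u] inside the domain, [h t = <g (x + t u), u>] satisfies
    [h ^ 2 <= nu * h'].  A positive initial value would make [- 1 / h], which
    then grows at rate at least [1 / nu], reach [0] in finite time. *)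
Lemma grad_ray_le0 x u : (forall t : R, 0 <= t -> D (x + t *: u)) ->
  dotv (g x) u <= 0.
Proof.
move=> Dt; pose h t := dotv (g (x + t *: u)) u.
pose dh t := dotv (H (x + t *: u) *m u) u.
have h'E (t : R) : 0 <= t -> is_derive t (1 : R) h (dh t).
  by move=> t0; exact: line_derive (Dt t t0).
have dhE (t : R) : 0 <= t -> dh t = N (x + t *: u) u ^+ 2.
  by move=> t0; rewrite /dh dotvC -hnorm_sqr //; exact: (bg_root bg (Dt t t0)).
have h0E : h 0 = dotv (g x) u by rewrite /h scale0r addr0.
rewrite -h0E leNgt; apply/negP => h0p.
have h_ge (t : R) : 0 <= t -> h 0 <= h t.
  rewrite le_eqVlt => /predU1P[<- //|tp].
  have [c /andP[c0 ct] e] := mvt_closed tp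
    (fun s st => h'E s (elimT andP st).1).
  by rewrite -subr_ge0 e dhE // subr0 mulr_ge0 ?sqr_ge0 // ltW.
have h_gt (t : R) : 0 <= t -> 0 < h t by move=> t0; exact: lt_le_trans (h_ge t t0).
have nu0 : 0 <= nu by apply: (param_ge0 (Dt 0 (lexx _))).
have h2 (t : R) : 0 <= t -> h t ^+ 2 <= nu * dh t.
  move=> t0; rewrite dhE // -[X in X * _]sqr_sqrtr // -exprMn.
  rewrite lerXn2r ?nnegrE ?mulr_ge0 ?sqrtr_ge0 ?hnorm_ge0 ?(ltW (h_gt _ _)) //.
  exact: (grad_le _ (Dt t t0)).
have nup : 0 < nu.
  rewrite lt_neqAle nu0 andbT; apply/negP => /eqP e.
  have := h2 0 (lexx _); rewrite -e mul0r leNgt.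
  by rewrite exprn_gt0.
have Tp : 0 < nu / h 0 by rewrite divr_gt0.
have inv' (t : R) : 0 <= t <= nu / h 0 ->
    is_derive t (1 : R) (fun s => (h s)^-1) (- (h t) ^- 2 *: dh t).
  move=> /andP[t0 _]; apply: is_deriveV; last exact: h'E.
  by rewrite gt_eqF // h_gt.
have [c /andP[c0 cT]] := mvt_closed Tp inv'; rewrite subr0.
move=> e.
have hT := h_gt _ (ltW Tp).
have hc := h_gt _ c0.
have : 1 <= (h c) ^- 2 * dh c * nu.
  by rewrite -mulrA ler_pdivlMl ?exprn_gt0 // mulr1 mulrC h2.
move: e; rewrite /GRing.scale /= mulNr.
set T := nu / h 0 in hT *; set q := _ * dh c => e q1.
have hTV : 0 < (h T)^-1 by rewrite invr_gt0.
have h0V : 0 < (h 0)^-1 by rewrite invr_gt0.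
have : (h T)^-1 - (h 0)^-1 = - (q * nu) * (h 0)^-1.
  by rewrite e /q /T; ring.
by nra.
Qed.

(** The function [t |-> <g (x + t u), u>] is nonpositive on the ray and has
    derivative [|u|_(x + t u) ^ 2].  Self-concordance gives
    [|u|_(x + t u) >= |u|_x / (1 + t |u|_x)], which is at least [|u|_x / 2] up to
    [t = 1 / |u|_x], so that the function increases there by at least
    [|u|_x / 4].  (Integrating over the whole ray would improve the constant
    to [1].) *)
Lemma grad_ray_quarter x u : (forall t : R, 0 <= t -> D (x + t *: u)) ->
  N x u / 4 <= - dotv (g x) u.
Proof.
move=> Dt; have Dx : D x by have := Dt 0 (lexx _); rewrite scale0r addr0.
set r := N x u; have : 0 <= r := hnorm_ge0 _ _.
rewrite le_eqVlt => /predU1P[<-|r0].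
  by rewrite mul0r oppr_ge0; exact: grad_ray_le0.
have rV : 0 < r^-1 by rewrite invr_gt0.
have [c /andP[c0 cr]] := mvt_closed rV
  (fun t ht => line_derive u (Dt t (elimT andP ht).1)).
have Dc := Dt c c0.
rewrite scale0r addr0 subr0 (dotvC (H _ *m u)) -hnorm_sqr;
  last exact: (bg_root bg Dc).
set q := N (x + c *: u) u => e.
have q0 : 0 <= q := hnorm_ge0 _ _.
have h1 : dotv (g (x + r^-1 *: u)) u <= 0.
  apply: grad_ray_le0 => t t0; rewrite -addrA -scalerDl.
  by apply: Dt; rewrite addr_ge0 // ltW.
have cr1 : c * r <= 1 by rewrite -ler_pdivlMr // mul1r.
have rq : r <= 2 * q.
  have nE : N (x + c *: u) (x - (x + c *: u)) = c * q.
    by rewrite opprD addrA subrr add0r hnormN hnormZ ger0_norm.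
  (* [x] is compared with the point of the ray through the ball centred there *)
  have [cq|cq] := ltP (c * q) 1.
    have := proj2 (bg_sc bg (v := x) u Dc _); rewrite nE => /(_ cq).
    by rewrite -/r -/q => h; nra.
  by nra.
have q2 : r ^+ 2 / 4 <= q ^+ 2 by nra.
have : r / 4 <= q ^+ 2 * r^-1.
  have -> : r / 4 = r ^+ 2 / 4 * r^-1 by field; rewrite gt_eqF.
  by rewrite ler_wpM2r // ltW.
lra.
Qed.

(** Since [<s, u> = <s + mu g x, u> - mu <g x, u>], the lower bound on the last
    term outweighs the residual. *)
Lemma dual_ray_ge0 x s u (mu c : R) : D x -> 0 < mu -> c <= mu / 4 ->
  (forall v, dotv (s + mu *: g x) v <= c * N x v) ->
  (forall t : R, 0 <= t -> D (x + t *: u)) -> 0 <= dotv u s.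
Proof.
move=> Dx mu0 cmu hs Dt.
have := hs (- u); rewrite hnormN !dotv_lin (dotvC u).
have := grad_ray_quarter Dt; have := hnorm_ge0 (H x) u.
by nra.
Qed.

Lemma bg_sym x u v : D x -> dotv u (H x *m v) = dotv (H x *m u) v.
Proof.
move=> /(bg_root bg) [S [[sS _] <-]].
by rewrite dotv_mulmx trmx_mul sS.
Qed.

(** The Newton equation turns the orthogonality of [x + dx] and [s + ds] into
    [<x + dx, H x *m dx> = 0], and [H x *m x = - g x]. *)
Lemma predictor_direction_le x s dx ds mu :
  D x -> 0 < mu -> ds + mu *: (H x *m dx) = - s -> dotv (x + dx) (s + ds) = 0 ->
  N x dx ^+ 2 = dotv (g x) dx /\ N x dx <= Num.sqrt nu.
Proof.
move=> Dx mu0 e o.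
have n2 : N x dx ^+ 2 = dotv (g x) dx.
  have es : s + ds = - mu *: (H x *m dx).
    by rewrite -[s]opprK -e opprD scaleNr addrAC addNr add0r.
  move: o; rewrite es dotvZr dotvDl (bg_sym _ _ Dx) (bg_hom bg Dx) dotvNl.
  move=> /eqP; rewrite mulf_eq0 oppr_eq0 gt_eqF //= => /eqP o.
  by rewrite (hnorm_sqr _ (bg_root bg Dx)); lra.
split=> //.
have := grad_le dx Dx; rewrite -n2 expr2.
have := hnorm_ge0 (H x) dx; rewrite le_eqVlt => /predU1P[<- _|n0].
  exact: sqrtr_ge0.
by rewrite ler_pM2r.
Qed.

(** In the numerical condition, the summands of the first bracket come from the
    residual, from the change of the gradient and from the linear term of the
    Newton equation, measured at [x]; the factor [1 / (1 - a)] passes to the norm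
    at the new point; the last summand and the factor [1 - a * eta] account for
    the deviation of [mu'] from [(1 - alpha) * mu]. *)
Lemma predictor_step x s dx ds (mu eta beta a alpha : R) :
  D x -> 0 < mu -> 1 <= nu -> dotv x s = nu * mu ->
  0 <= eta -> (forall v, dotv (s + mu *: g x) v <= eta * mu * N x v) ->
  ds + mu *: (H x *m dx) = - s -> dotv (x + dx) (s + ds) = 0 ->
  0 <= alpha -> alpha * Num.sqrt nu <= a -> a < 1 -> a * eta < 1 ->
  (eta + a / (1 - a) ^+ 2 + a / (1 - a)) / (1 - a) + a * eta
    <= beta * (1 - a * eta) ->
  let x' := x + alpha *: dx in let s' := s + alpha *: ds in
  let mu' := dotv x' s' / nu in
  [/\ D x', 0 < mu' &
      forall v, dotv (s' + mu' *: g x') v <= beta * mu' * N x' v].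
Proof.
move=> Dx mu0 nu1 xs eta0 hpsi e o al0 als a1 ae hnum x' s' mu'.
have [n2 nle] := predictor_direction_le Dx mu0 e o.
have snu1 : 1 <= Num.sqrt nu by rewrite -sqrtr1 ler_wsqrtr.
have ala : alpha <= a by apply: le_trans als; rewrite ler_peMr.
have a0 : 0 <= a := le_trans al0 ala.
have sub1 : 0 < 1 - alpha by rewrite subr_gt0; exact: le_lt_trans a1.
have sub1a : 0 < 1 - a by rewrite subr_gt0.
set r := N x dx in n2 nle; have r0 : 0 <= r := hnorm_ge0 _ _.
have ara : alpha * r <= a by apply: le_trans als; rewrite ler_wpM2l.
have nd : N x (alpha *: dx) = alpha * r by rewrite hnormZ ger0_norm.
have x'x : x' - x = alpha *: dx by rewrite /x' addrC addKr.
have nx' : N x (x' - x) < 1 by rewrite x'x nd; exact: le_lt_trans a1.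
have Dx' : D x' := bg_dikin bg Dx nx'.
have dsE : ds = - s - mu *: (H x *m dx) by rewrite -e addrK.
set p := dotv (s + mu *: g x) dx.
have pE : p = dotv s dx + mu * r ^+ 2 by rewrite /p !dotv_lin n2.
(* [<dx, s>] and [mu |dx|_x ^ 2] cancel up to the residual paired with [dx] *)
have dxds : dotv dx ds = - p.
  by rewrite dsE !dotv_lin pE (dotvC dx s) -(hnorm_sqr _ (bg_root bg Dx)) -/r; ring.
have mu'nu : dotv x' s' = (1 - alpha) * (nu * mu + alpha * p).
  move: o; rewrite /x' /s' !dotv_lin dxds xs => o.
  have -> : dotv x ds = p - dotv dx s - nu * mu by lra.
  by ring.
have nup : 0 < nu by lra.
pose del := alpha * p / (nu * mu).
have mu'E : mu' = (1 - alpha) * mu * (1 + del).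
  by rewrite /mu' mu'nu /del; field; rewrite !gt_eqF.
have pabs : `|p| <= eta * mu * Num.sqrt nu.
  have em : 0 <= eta * mu by rewrite mulr_ge0 // ltW.
  rewrite ler_norml; apply/andP; split; last first.
    by apply: le_trans (hpsi _) _; rewrite ler_wpM2l.
  have := hpsi (- dx); rewrite dotvNr hnormN -/p lerNl => h.
  by apply: le_trans h; rewrite lerN2 ler_wpM2l.
(* the factor [sqrt nu] is that of the dual norm of the gradient *)
have dels : `|del| * Num.sqrt nu <= a * eta.
  rewrite /del normrM normfV normrM (ger0_norm al0) (gtr0_norm (mulr_gt0 nup mu0)).
  rewrite mulrAC ler_pdivrMr ?mulr_gt0 //.
  have -> : a * eta * (nu * mu) = a * (eta * mu * Num.sqrt nu * Num.sqrt nu).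
    by rewrite -(mulrA (eta * mu)) -expr2 sqr_sqrtr ?ltW //; ring.
  rewrite -[leLHS]mulrA; apply: ler_pM => //.
  by rewrite ler_wpM2r ?sqrtr_ge0.
have dela : `|del| <= a * eta by apply: le_trans dels; rewrite ler_peMr.
have /andP[dlo dhi] : - (a * eta) <= del <= a * eta by rewrite -ler_norml.
have mu'_ge : (1 - alpha) * mu * (1 - a * eta) <= mu'.
  rewrite mu'E ler_wpM2l ?(ltW (mulr_gt0 sub1 mu0)) //.
  by rewrite lerD2l.
have mu'0 : 0 < mu'.
  by apply: lt_le_trans mu'_ge; rewrite !mulr_gt0 // subr_gt0.
split=> // v.
set n := N x v; set n' := N x' v.
have n0 : 0 <= n := hnorm_ge0 _ _.
have n'0 : 0 <= n' := hnorm_ge0 _ _.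
have nn' : n <= n' / (1 - a).
  rewrite ler_pdivlMr // mulrC; apply: le_trans (proj1 (bg_sc bg v Dx nx')).
  by rewrite ler_wpM2r // lerD2l lerN2 x'x nd.
have -> : s' + mu' *: g x' = (1 - alpha) *: (s + mu *: g x)
   + ((1 - alpha) * mu) *: (g x' - g x) - (alpha * mu) *: (H x *m dx)
   + ((1 - alpha) * mu * del) *: g x'.
  rewrite mu'E /s' dsE.
  by apply/matrixP => i j; rewrite !mxE; ring.
have t1 : dotv (s + mu *: g x) v <= eta * mu * n := hpsi v.
have t2 : dotv (g x' - g x) v <= a / (1 - a) ^+ 2 * n.
  have a1' : alpha * r < 1 by exact: le_lt_trans a1.
  have := grad_lipschitz v Dx (d := alpha *: dx); rewrite nd => /(_ a1').
  rewrite -/x' -/n => h; apply: le_trans h _; rewrite ler_wpM2r //.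
  apply: ler_pM; [by rewrite mulr_ge0 | by rewrite invr_ge0 sqr_ge0 | by [] |].
  have b1 : 1 - a <= 1 - alpha * r by rewrite lerD2l lerN2.
  by rewrite lef_pV2 ?posrE ?exprn_gt0 ?subr_gt0 // lerXn2r ?nnegrE // ltW ?subr_gt0.
have t3 : - dotv (H x *m dx) v <= r * n.
  rewrite -dotvNr -[n](hnormN (H x) v).
  exact: hnorm_dot (bg_root bg Dx).
have t4 : del * dotv (g x') v <= a * eta * n'.
  apply: le_trans (ler_norm _) _; rewrite normrM.
  apply: le_trans (_ : `|del| * (Num.sqrt nu * n') <= _).
    rewrite ler_wpM2l // ler_norml; apply/andP; split.
      exact: (grad_ge v Dx').
    exact: (grad_le v Dx').
  by rewrite mulrA ler_wpM2r.
rewrite [leLHS]dotvDl dotvDl dotvNl dotvDl !dotvZl.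
set c := (1 - alpha) * mu; have c0 : 0 < c by rewrite mulr_gt0.
have s1 : (1 - alpha) * dotv (s + mu *: g x) v <= c * (eta * n).
  have -> : c * (eta * n) = (1 - alpha) * (eta * mu * n) by rewrite /c; ring.
  by rewrite ler_pM2l.
have s2 : c * dotv (g x' - g x) v <= c * (a / (1 - a) ^+ 2 * n).
  by rewrite ler_pM2l.
have s3 : - (alpha * mu * dotv (H x *m dx) v) <= c * (a / (1 - a) * n).
  rewrite -mulrN; apply: le_trans (_ : alpha * mu * (r * n) <= _).
    by rewrite ler_wpM2l ?mulr_ge0 // ltW.
  have -> : alpha * mu * (r * n) = (mu * n) * (alpha * r) by ring.
  have -> : c * (a / (1 - a) * n) = (mu * n) * (a * ((1 - alpha) / (1 - a))).
    by rewrite /c; ring.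
  rewrite ler_wpM2l ?mulr_ge0 ?(ltW mu0) //; apply: le_trans ara _.
  by rewrite ler_peMr // ler_pdivlMr // mul1r lerD2l lerN2.
have s4 : c * del * dotv (g x') v <= c * (a * eta * n').
  by rewrite -mulrA ler_pM2l.
have X0 : 0 <= eta + a / (1 - a) ^+ 2 + a / (1 - a).
  by rewrite !addr_ge0 // mulr_ge0 ?invr_ge0 ?exprn_ge0 // ltW.
have s5 : (eta + a / (1 - a) ^+ 2 + a / (1 - a)) * n + a * eta * n'
    <= beta * (1 - a * eta) * n'.
  apply: le_trans (_ : ((eta + a / (1 - a) ^+ 2 + a / (1 - a)) / (1 - a)
     + a * eta) * n' <= _); last by rewrite ler_wpM2r.
  by rewrite [leRHS]mulrDl lerD2r -mulrA (mulrC _^-1) ler_wpM2l.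
have b0 : 0 <= beta.
  have : 0 <= beta * (1 - a * eta).
    apply: le_trans hnum; apply: addr_ge0; last exact: mulr_ge0.
    by rewrite mulr_ge0 // invr_ge0 ltW.
  by rewrite pmulr_lge0 // subr_gt0.
apply: le_trans (_ : c * (beta * (1 - a * eta) * n') <= _).
  apply: le_trans (_ : c * ((eta + a / (1 - a) ^+ 2 + a / (1 - a)) * n
    + a * eta * n') <= _); last by rewrite ler_pM2l.
  by rewrite !mulrDl !mulrDr; lra.
have -> : c * (beta * (1 - a * eta) * n') = beta * (c * (1 - a * eta)) * n' by ring.
by rewrite ler_wpM2r // ler_wpM2l.
Qed.

End Geometry.

(** * The barrier on the original cone *)

Section Lines.
Variables (R : realType) (V : normedModType R).
Implicit Types (x v : V).

Lemma near_line x v (A : set V) : nbhs x A ->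
  \forall t \near (0 : R), A (x + t *: v).
Proof.
move=> Ax; have : (fun t : R => x + t *: v) t @[t --> (0 : R)] --> x.
  rewrite -[X in _ --> X]addr0 -[X in _ --> (_ + X)](scale0r v).
  by apply: cvgD; [exact: cvg_cst | exact: scalel_continuous].
exact.
Qed.

Lemma is_derive_line (W : normedModType R) (f : V -> W) x v df :
  is_derive x v f df -> is_derive (0 : R) (1 : R) (fun t : R => f (x + t *: v)) df.
Proof.
have -> : (fun t : R => f (x + t *: v)) = (fun t => f (t *: v + x)).
  by apply/funext => t; rewrite addrC.
move=> [/derivable1P fd <-]; split=> //.
rewrite /derive; set g1 := fun t => t^-1 *: _; set g2 := fun t => t^-1 *: _.
suff -> : g1 = g2 by [].
by apply/funext => t; rewrite /g1 /g2 /= addr0 scale0r add0r [_%:A]mulr1.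
Qed.

End Lines.

Section ConeBarrier.
Variables (R : realType) (n : nat).
Implicit Types (x u v w : 'cV[R]_n).

Lemma derive_coord (W : normedModType R) (f : 'cV[R]_n -> W) x u :
  differentiable f x -> 'D_u f x = \sum_j u j 0 *: 'D_(delta_mx j 0) f x.
Proof.
move=> df; rewrite deriveE // {1}[u]matrix_sum_delta linear_sum.
apply: eq_bigr => j _; rewrite big_ord1 linearZ deriveE //.
Qed.

Lemma derive_grad (F : 'cV[R]_n -> R) x u : differentiable F x ->
  'D_u F x = dotv (grad F x) u.
Proof.
move=> dF; rewrite derive_coord // dotvE; apply: eq_bigr => j _.
by rewrite mxE mulrC.
Qed.

Lemma grad_derive_line (F : 'cV[R]_n -> R) x u w : differentiable (grad F) x ->
  is_derive (0 : R) (1 : R) (fun t : R => dotv (grad F (x + t *: u)) w)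
    (dotv (hess F x *m u) w).
Proof.
move=> dG.
have der v : derivable (grad F) x v by exact: diff_derivable.
have gi i : is_derive x u (fun y => grad F y i 0) ((hess F x *m u) i 0).
  split; first exact: ((derivable_mxP _ _ _).1 (der u) i 0).
  have := derive_mx (der u) => /matrixP /(_ i 0); rewrite mxE => <-.
  rewrite derive_coord // summxE mxE; apply: eq_bigr => j _.
  by rewrite !mxE derive_mx // mxE mulrC.
have -> : (fun t : R => dotv (grad F (x + t *: u)) w) =
    \sum_i (w i 0 *: (fun t : R => grad F (x + t *: u) i 0)).
  apply/funext => t; rewrite dotvE fct_sumE; apply: eq_bigr => i _.
  by rewrite mulrC.
have -> : dotv (hess F x *m u) w = \sum_i (w i 0 *: (hess F x *m u) i 0).
  by rewrite dotvE; apply: eq_bigr => i _; rewrite mulrC.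
apply: is_derive_sum => i.
apply: is_deriveZ; exact: (is_derive_line (gi i)).
Qed.

(** If [hess F x] had no positive definite square root, its default value [0]
    would make [lnorm F x] vanish identically, and the inequality
    [1 <= |v|_x / |v|_x] required for [u = x] would fail. Thus the root is part
    of what self-concordance asserts. *)
Lemma self_concordant_root (K : set 'cV[R]_n) F x : (0 < n)%N ->
  self_concordant K F -> K° x -> has_root (hess F x).
Proof.
case: n K F x => // n' K F x _ sc Kx.
have [//|nr] := pselect (has_root (hess F x)).
have s0 : sqrtmx (hess F x) = 0.
  by rewrite /sqrtmx xgetPN // => S hS; apply: nr; exists S.
have l0 (v : 'cV[R]_n'.+1) : lnorm F x v = 0.
  by rewrite /lnorm s0 mul0mx /enorm /dotv mulmx0 mxE sqrtr0.
have v0 : const_mx 1 != 0 :> 'cV[R]_n'.+1.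
  by apply/eqP => /matrixP/(_ 0 0); rewrite !mxE => /eqP; rewrite oner_eq0.
have [_ /(_ x (const_mx 1))] := sc _ Kx.
rewrite /lball /= !l0 ltr01 => /(_ isT v0) []; rewrite mul0r subr0.
by rewrite ler10.
Qed.

Let norm_bounds0 (r a b : R) : a = 0 -> b = 0 ->
  (1 - r) * a <= b /\ (1 - r) * b <= a.
Proof. by move=> -> ->; rewrite mulr0. Qed.

Let norm_bounds_of_ratio (r a b : R) : r < 1 -> 0 < a ->
  1 - r <= b / a /\ b / a <= 1 / (1 - r) ->
  (1 - r) * a <= b /\ (1 - r) * b <= a.
Proof.
move=> r1 a0; rewrite ler_pdivlMr // ler_pdivrMr // mulrAC mul1r.
by rewrite ler_pdivlMr ?subr_gt0 // (mulrC b).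
Qed.

(** Differentiating [F (t x) = F x - nu ln t] in [t] at [1] gives
    [<x, g x> = - nu]; differentiating this identity in [x] and using the symmetry
    of the Hessian gives [H x *m x = - g x]. *)
Lemma barrier_geometry_lhb (K : set 'cV[R]_n) F nu : (0 < n)%N ->
  lh_barrier K F nu -> barrier_geometry K° (grad F) (hess F) nu.
Proof.
move=> n0 hF; have sc := lhb_sc hF.
have rootF x : K° x -> has_root (hess F x) by exact: self_concordant_root n0 sc.
have nearK x v : K° x -> \forall t \near (0 : R), K° (x + t *: v).
  by move=> Kx; apply: near_line; move: Kx => /nbhs_interior.
have dline x u w : K° x -> is_derive (0 : R) (1 : R)
    (fun t : R => dotv (grad F (x + t *: u)) w) (dotv (hess F x *m u) w).
  by move=> Kx; apply: grad_derive_line; have [] := lhb_C2 hF Kx.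
(* logarithmic homogeneity, differentiated along the ray through [x] *)
have param x : K° x -> dotv x (grad F x) = - nu.
  move=> Kx; have [dF _ _ _] := lhb_C2 hF Kx.
  have d1 := is_derive_line (derivableP (diff_derivable (v := x) dF)).
  have d2 : is_derive (0 : R) (1 : R)
      (fun t : R => F x - nu * ln (1 + t)) (- nu).
    have d3 : is_derive (1 + 0 : R) (1 : R) (@ln R) 1^-1.
      by rewrite addr0; exact: is_derive1_ln ltr01.
    have d4 : is_derive (0 : R) (1 : R) (fun t : R => 1 + t) 1.
      have := is_derive_shift (0 : R) 1 1.
      by congr is_derive; apply/funext => t /=; rewrite addrC.
    have d5 := @is_derive1_comp _ _ (fun t => 1 + t) _ _ _ d3 d4.
    have := is_deriveB (is_derive_cst (F x) (0 : R) (1 : R)) (is_deriveZ nu d5).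
    move=> d6; apply: is_derive_eq d6 _.
    by rewrite invr1 mulr1 sub0r /GRing.scale /= mulr1.
  rewrite dotvC -derive_grad // -(@derive_val _ _ _ _ _ _ _ d1).
  rewrite -(@derive_val _ _ _ _ _ _ _ d2); apply: near_eq_derive.
  near=> t.
  have t1 : 0 < 1 + t.
    by rewrite -ltrBlDl sub0r; near: t; exact: (lt_nbhsr (ltrN10 R)).
  by rewrite -(lhb_loghom hF Kx t1) scalerDl scale1r.
split=> //.
- move=> x v Kx; rewrite -lnormE; last exact: rootF.
  by have [+ _] := sc x Kx; exact.
- move=> x v w Kx r1; have rx := rootF x Kx.
  have [/(_ v) Kv /(_ v w)] := sc x Kx; rewrite /lball /= lnormE //.
  move=> /(_ r1); rewrite /lball /= lnormE // in Kv.
  have rv := rootF v (Kv r1).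
  have [w0 _|w0] := eqVneq w 0.
    have hw M : hnorm M w = 0 by rewrite w0 hnorm0.
    exact: norm_bounds0 (hw (hess F x)) (hw (hess F v)).
  rewrite !lnormE // => /(_ isT); apply: norm_bounds_of_ratio => //.
  exact: hnorm_gt0.
- move=> x Kx; apply/eqP; rewrite -addr_eq0; apply/eqP; apply: dotv_eq0.
  set z := hess F x *m x + grad F x.
  have [_ _ _ [sH _]] := lhb_C2 hF Kx.
  suff main v : dotv (hess F x *m x) v + dotv (grad F x) v = 0.
    by rewrite {1}/z dotvDl main.
  (* derivative at [0] of the constant [t |-> <g (x + t v), x + t v>] *)
  have d1 := dline x v x Kx; have d2 := dline x v v Kx.
  have d3 := is_deriveD d1 (is_deriveM (is_derive_id (0 : R) (1 : R)) d2).
  have := @derive_val _ _ _ _ _ _ _ d3.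
  rewrite (@near_eq_derive _ _ _ _ (cst (- nu))); last first.
    near=> t; rewrite -(param (x + t *: v)); last first.
      by near: t; exact: nearK.
    by rewrite (dotvC _ (grad _ _)) dotvDr dotvZr.
  rewrite derive_cst /= scale0r add0r scale0r addr0 /GRing.scale /= mulr1.
  by rewrite dotv_mulmx sH dotvC => <-.
Unshelve. all: by end_near. Qed.

End ConeBarrier.

(** * Adjoining the homogenizing variable *)

Section Extension.
Variables (R : realType) (n : nat).
Local Notation ext := 'cV[R]_(n + 1).
Local Notation tau xb := (dsubmx xb 0 0).
Implicit Types (u v w xb : ext).

Lemma dotv_ext u v : dotv u v = dotv (usubmx u) (usubmx v) + tau u * tau v.
Proof.
rewrite !dotvE big_split_ord /= big_ord1; congr (_ + _); last by rewrite !mxE.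
by apply: eq_bigr => i _; rewrite !mxE.
Qed.

Lemma ext_eq u v : usubmx u = usubmx v -> tau u = tau v -> u = v.
Proof.
move=> e1 e2; rewrite -[u]vsubmxK -[v]vsubmxK e1; congr col_mx.
by apply/matrixP => i j; rewrite !ord1.
Qed.

Definition ext_grad (g : 'cV[R]_n -> 'cV[R]_n) xb : ext :=
  col_mx (g (usubmx xb)) (const_mx (- (tau xb)^-1)).

Definition ext_hess (H : 'cV[R]_n -> 'M[R]_n) xb : 'M[R]_(n + 1) :=
  block_mx (H (usubmx xb)) 0 0 ((tau xb) ^- 2)%:M.

Definition ext_dom (D : set 'cV[R]_n) : set ext :=
  [set xb | D (usubmx xb) /\ 0 < tau xb].

Lemma usub_block (M : 'M[R]_n) (a : R) u :
  usubmx (block_mx M 0 0 a%:M *m u) = M *m usubmx u.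
Proof.
by rewrite -{1}[u]vsubmxK mul_block_col col_mxKu mul0mx addr0.
Qed.

Lemma dsub_block (M : 'M[R]_n) (a : R) u :
  tau (block_mx M 0 0 a%:M *m u) = a * tau u.
Proof.
by rewrite -{1}[u]vsubmxK mul_block_col col_mxKd mul0mx add0r mul_scalar_mx mxE.
Qed.

Lemma root_block (M : 'M[R]_n) (a : R) : has_root M -> 0 < a ->
  has_root (block_mx M 0 0 (a ^+ 2)%:M : 'M[R]_(n + 1)).
Proof.
move=> [S [[sS pS] SS]] a0; exists (block_mx S 0 0 a%:M); split.
  split=> [|u u0]; first by rewrite tr_block_mx sS !trmx0 tr_scalar_mx.
  rewrite dotv_ext usub_block dsub_block mulrCA -expr2.
  have [u10|u1] := eqVneq (usubmx u) 0; last first.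
    by rewrite ltr_pwDl ?pS // mulr_ge0 ?sqr_ge0 // ltW.
  rewrite u10 /dotv mulmx0 mulmx0 mxE add0r mulr_gt0 // exprn_even_gt0 //=.
  apply: contra u0 => /eqP u20; apply/eqP.
  by apply: ext_eq; rewrite ?u10 ?u20 ?linear0 // mxE.
rewrite mulmx_block SS !mul0mx !mulmx0 !addr0 !add0r -scalar_mxM.
by rewrite expr2.
Qed.

Lemma ext_root H xb : has_root (H (usubmx xb)) -> 0 < tau xb ->
  has_root (ext_hess H xb).
Proof. by move=> r t0; rewrite /ext_hess -exprVn; apply: root_block; rewrite ?invr_gt0. Qed.

Lemma ext_hnorm_sqr H xb u : has_root (H (usubmx xb)) -> 0 < tau xb ->
  hnorm (ext_hess H xb) u ^+ 2 =
  hnorm (H (usubmx xb)) (usubmx u) ^+ 2 + (tau u / tau xb) ^+ 2.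
Proof.
move=> r t0; rewrite !hnorm_sqr //; last exact: ext_root.
rewrite dotv_ext usub_block dsub_block; congr (_ + _).
by rewrite exprMn exprVn; ring.
Qed.

Lemma ler_sqr_sum (a b c d e : R) : 0 <= e -> 0 <= a ->
  e * a <= c -> (e * b) ^+ 2 <= d ^+ 2 ->
  e ^+ 2 * (a ^+ 2 + b ^+ 2) <= c ^+ 2 + d ^+ 2.
Proof.
move=> e0 a0 h1 h2; rewrite mulrDr -!exprMn lerD //.
by rewrite lerXn2r ?nnegrE ?mulr_ge0 // (le_trans _ h1) ?mulr_ge0.
Qed.

Let ler_of_sqr (a b : R) : 0 <= b -> a ^+ 2 <= b ^+ 2 -> a <= b.
Proof. by move=> b0 h; rewrite leNgt; apply/negP => ba; nra. Qed.

(** Adding [- log tau] to a barrier adds orthogonal blocks to the Hessian, so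
    that each estimate holds componentwise, with the two component distances
    bounded by the total one. *)
Lemma barrier_geometry_ext D g H nu : barrier_geometry D g H nu ->
  barrier_geometry (ext_dom D) (ext_grad g) (ext_hess H) (nu + 1).
Proof.
move=> bg; have rt x : D x -> has_root (H x) := @bg_root _ _ _ _ _ _ bg x.
have extr xb : ext_dom D xb -> has_root (ext_hess H xb).
  by case=> Dx t0; apply: ext_root => //; exact: rt.
have dist xb v : ext_dom D xb ->
    let r := hnorm (ext_hess H xb) (v - xb) in
    [/\ 0 <= r, hnorm (H (usubmx xb)) (usubmx v - usubmx xb) <= r
      & `|tau v - tau xb| <= r * tau xb].
  move=> [Dx t0] r; have r0 : 0 <= r := hnorm_ge0 _ _.
  have := ext_hnorm_sqr (v - xb) (rt _ Dx) t0; rewrite -/r linearB /=.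
  have -> : tau (v - xb) = tau v - tau xb by rewrite !mxE.
  set a := hnorm _ _; set b := tau v - _ => e.
  have a0 : 0 <= a := hnorm_ge0 _ _.
  split=> //.
    by apply: ler_of_sqr => //; rewrite e lerDl sqr_ge0.
  rewrite -ler_pdivrMr // -[X in _ / X]gtr0_norm // -normfV -normrM.
  by apply: ler_of_sqr => //; rewrite e real_normK ?num_real // lerDr sqr_ge0.
have dikin xb v : ext_dom D xb -> hnorm (ext_hess H xb) (v - xb) < 1 ->
    ext_dom D v.
  move=> Dxb r1; have [r0 ra rb] := dist xb v Dxb; case: (Dxb) => Dx t0; split.
    by apply: (bg_dikin bg Dx); exact: le_lt_trans r1.
  by move: rb; rewrite ler_norml => /andP[]; nra.
split=> //.
- move=> xb u w [Dx t0].
  have d1 := bg_deriv bg (usubmx u) (usubmx w) Dx.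
  have d2 : is_derive (0 : R) (1 : R) (fun t : R => tau xb + t * tau u) (tau u).
    have := is_deriveD (is_derive_cst (tau xb) (0 : R) (1 : R))
      (is_deriveM (is_derive_id (0 : R) (1 : R)) (is_derive_cst (tau u) (0 : R) (1 : R))).
    move=> d; apply: is_derive_eq d _.
    by rewrite /= scaler0 !add0r /GRing.scale /= mulr1.
  have t0' : tau xb + 0 * tau u != 0 by rewrite mul0r addr0 gt_eqF.
  have d3 := @is_deriveV _ (fun t : R => tau xb + t * tau u) _ _ _ t0' d2.
  have d4 := is_deriveZ (tau w) (is_deriveN d3).
  have d5 := is_deriveD d1 d4.
  have eqf : (fun t : R => dotv (ext_grad g (xb + t *: u)) w) =
     (fun t : R => dotv (g (usubmx xb + t *: usubmx u)) (usubmx w)) +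
      tau w *: - (fun t : R => (tau xb + t * tau u)^-1).
    apply/funext => t; rewrite dotv_ext /ext_grad col_mxKu col_mxKd linearD linearZ /=.
    by rewrite [in X in _ + X]mxE !fctE mulrC /GRing.scale /= !mxE.
  rewrite eqf; apply: is_derive_eq d5 _.
  rewrite dotv_ext usub_block dsub_block; congr (_ + _).
  by rewrite /GRing.scale /= mul0r addr0; ring.
- move=> xb v w Dxb r1; have Dv := dikin _ _ Dxb r1.
  have [r0 ra rb] := dist xb v Dxb; set r := hnorm _ _ in r0 ra rb r1 *.
  case: (Dxb) => Dx t0; case: (Dv) => Dv' tv0.
  have ra1 := le_lt_trans ra r1.
  have [l1 l2] := bg_sc bg (usubmx w) Dx ra1.
  set q := hnorm _ _ in ra ra1 l1 l2.
  have e0 : 0 <= 1 - r by rewrite subr_ge0 ltW.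
  have nx := ext_hnorm_sqr w (rt _ Dx) t0.
  have nv := ext_hnorm_sqr w (rt _ Dv') tv0.
  set X := hnorm _ (usubmx w) in l1 l2 nx; set V := hnorm _ (usubmx w) in l1 l2 nv.
  have X0 : 0 <= X := hnorm_ge0 _ _.
  have V0 : 0 <= V := hnorm_ge0 _ _.
  set NX := hnorm _ w in nx *; set NV := hnorm _ w in nv *.
  have NX0 : 0 <= NX := hnorm_ge0 _ _.
  have NV0 : 0 <= NV := hnorm_ge0 _ _.
  have m1 : (1 - r) * X <= V by apply: le_trans l1; rewrite ler_wpM2r // lerD2l lerN2.
  have m2 : (1 - r) * V <= X by apply: le_trans l2; rewrite ler_wpM2r // lerD2l lerN2.
  move: rb; rewrite ler_norml => /andP[rb1 rb2].
  have sqle (a b : R) : 0 < a -> 0 < b -> (1 - r) * b <= a ->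
      ((1 - r) * `|tau w / a|) ^+ 2 <= (tau w / b) ^+ 2.
    move=> a0 b0 ba; rewrite -[leRHS]real_normK ?num_real //.
    rewrite lerXn2r ?nnegrE ?mulr_ge0 // !normrM !normfV (gtr0_norm a0) (gtr0_norm b0).
    rewrite mulrCA ler_wpM2l // ler_pdivrMr // mulrC ler_pdivlMr //.
  have k1 : (1 - r) * tau v <= tau xb by nra.
  have k2 : (1 - r) * tau xb <= tau v by nra.
  split; apply: ler_of_sqr => //; rewrite exprMn nx nv.
    rewrite -[X in _ * (_ + X)]real_normK ?num_real //.
    by apply: ler_sqr_sum => //; exact: sqle.
  rewrite -[X in _ * (_ + X)]real_normK ?num_real //.
  by apply: ler_sqr_sum => //; exact: sqle.
- move=> xb [Dx t0]; apply: ext_eq.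
    by rewrite usub_block (bg_hom bg Dx) linearN /= col_mxKu.
  move: t0; rewrite dsub_block linearN /= col_mxKd !mxE => t0.
  by rewrite opprK expr2 invfM -mulrA mulVf ?mulr1 // gt_eqF.
- move=> xb [Dx t0]; rewrite dotv_ext col_mxKu col_mxKd (bg_param bg Dx).
  move: t0; rewrite !mxE => t0.
  by rewrite mulrN mulfV ?gt_eqF // opprD.
Qed.

(** Directional derivatives depend only on increments along the line; this
    reduces the partial derivatives of [bar_fun F] to those of [F] and of [ln]. *)
Lemma derive_transfer (V V' W : normedModType R) (f : V -> W) (f' : V' -> W)
    (x v : V) (x' v' : V') :
  (forall h : R, f (h *: v + x) - f x = f' (h *: v' + x') - f' x') ->
  'D_v f x = 'D_v' f' x'.
Proof.
move=> e; rewrite /derive; set g1 := fun h => h^-1 *: _; set g2 := fun h => h^-1 *: _.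
suff -> : g1 = g2 by [].
by apply/funext => h; rewrite /g1 /g2 /= e.
Qed.

Lemma usub_delta i : usubmx (delta_mx (lshift 1 i) 0 : ext) = delta_mx i 0.
Proof. by apply/matrixP => a b; rewrite !mxE (inj_eq (@lshift_inj _ _)). Qed.

Lemma tau_delta i : tau (delta_mx (lshift 1 i) 0 : ext) = 0.
Proof. by rewrite !mxE eq_rlshift. Qed.

Lemma usub_delta1 : usubmx (delta_mx (rshift n 0) 0 : ext) = 0.
Proof. by apply/matrixP => a b; rewrite !mxE eq_lrshift. Qed.

Lemma tau_delta1 : tau (delta_mx (rshift n 0) 0 : ext) = 1.
Proof. by rewrite !mxE !eqxx. Qed.

Lemma tau_line (h : R) u xb : tau (h *: u + xb) = h * tau u + tau xb.
Proof. by rewrite !mxE. Qed.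

Variable F : 'cV[R]_n -> R.

Lemma bar_grad_l xb i : grad (bar_fun F) xb (lshift 1 i) 0 = grad F (usubmx xb) i 0.
Proof.
rewrite !mxE; apply: derive_transfer => h.
rewrite /bar_fun tau_line tau_delta mulr0 add0r linearD linearZ /= usub_delta.
by rewrite opprB addrA subrK.
Qed.

Lemma bar_grad_r xb : 0 < tau xb ->
  grad (bar_fun F) xb (rshift n 0) 0 = - (tau xb)^-1.
Proof.
move=> t0; rewrite mxE.
rewrite (@derive_transfer _ _ _ _ (fun s : R => - ln s) _ _ (tau xb) 1).
  have d : is_derive (tau xb) (1 : R) (fun s : R => - ln s) (- (tau xb)^-1).
    exact: (is_deriveN (is_derive1_ln t0)).
  exact: (@derive_val _ _ _ _ _ _ _ d).
move=> h; rewrite /bar_fun tau_line tau_delta1 mulr1 linearD linearZ /= usub_delta1.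
by rewrite scaler0 add0r [h *: 1]mulr1; ring.
Qed.

Lemma bar_gradE xb : 0 < tau xb ->
  grad (bar_fun F) xb = ext_grad (grad F) xb.
Proof.
move=> t0; apply/matrixP => i j; rewrite (ord1 j) -[i]fintype.splitK.
case: (fintype.split i) => [k|k] /=; first by rewrite bar_grad_l /ext_grad col_mxEu.
by rewrite (ord1 k) bar_grad_r // /ext_grad col_mxEd [RHS]mxE.
Qed.

Lemma near_tau_gt0 xb : 0 < tau xb -> \forall y \near xb, 0 < tau y.
Proof.
move=> t0; have tE (y : ext) : tau y = y (rshift n 0) 0 by rewrite !mxE.
have c := @coord_continuous R (n + 1) 1 (rshift n 0) 0 xb.
have h : \forall s \near xb (rshift n 0) 0, 0 < s by apply: lt_nbhsr; rewrite -tE.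
have h2 : nbhs xb [set y : ext | 0 < y (rshift n 0) 0] := c _ h.
by apply: filterS h2 => y /=; rewrite tE.
Qed.

Lemma bar_hessE xb : 0 < tau xb ->
  hess (bar_fun F) xb = ext_hess (hess F) xb.
Proof.
move=> t0; apply/matrixP => i j; rewrite mxE -[i]fintype.splitK -[j]fintype.splitK.
case: (fintype.split i) => [i'|i']; case: (fintype.split j) => [j'|j']; rewrite /unsplit /ext_hess.
- rewrite block_mxEul mxE; apply: derive_transfer => h.
  by rewrite !bar_grad_l linearD linearZ /= usub_delta.
- rewrite (ord1 j') block_mxEur mxE.
  rewrite (@derive_transfer _ _ _ _ (fun _ : R => 0 : R) _ _ 0 0) ?derive_cst //.
  move=> h; rewrite !bar_grad_l linearD linearZ /= usub_delta1.
  by rewrite scaler0 add0r !subrr.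
- rewrite (ord1 i') block_mxEdl mxE.
  rewrite (@derive_transfer _ _ _ _ (fun _ : R => 0 : R) _ _ 0 0) ?derive_cst //.
  move=> h; have e : tau (h *: delta_mx (lshift 1 j') 0 + xb) = tau xb.
    by rewrite tau_line tau_delta mulr0 add0r.
  by rewrite !bar_grad_r ?e // !subrr.
- rewrite (ord1 i') (ord1 j') block_mxEdr mxE eqxx mulr1n.
  rewrite (@near_eq_derive _ _ _ _ (fun y : ext => - (tau y)^-1)); last first.
    near=> y; apply: bar_grad_r; near: y; exact: near_tau_gt0.
  rewrite (@derive_transfer _ _ _ _ (fun s : R => - s^-1) _ _ (tau xb) 1).
    have t1 : tau xb != 0 by rewrite gt_eqF.
    have d := is_deriveN (@is_deriveV _ (fun s : R => s) _ _ _ t1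
      (is_derive_id (tau xb) (1 : R))).
    have := @derive_val _ _ _ _ _ _ _ d => ->.
    by rewrite /GRing.scale /= mulr1 opprK.
  by move=> h; rewrite tau_line tau_delta1 mulr1 [h *: 1]mulr1.
Unshelve. all: by end_near. Qed.

End Extension.

(** * Cones, their extensions and their interiors *)

Section Cones.
Variables (R : realType) (n m : nat).
Local Notation ext := 'cV[R]_(n + 1).
Local Notation tau xb := (dsubmx xb 0 0).
Implicit Types (K : set 'cV[R]_n).

Lemma continuous_usubmx (p q : nat) :
  continuous (usubmx : 'cV[R]_(p + q) -> 'cV[R]_p).
Proof.
move=> u A /nbhs_ballP[e /= e0 eA].
apply/nbhs_ballP; exists e => //= v [_ uv]; apply: eA; split => // i j.
by apply: (le_lt_trans _ (uv (lshift q i) j)); rewrite !mxE.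
Qed.

Lemma bar_cone_interior K (xb : ext) : (bar_cone K)° xb <-> ext_dom K° xb.
Proof.
split=> [/nbhs_ballP[e /= e0 sub]|[Kx t0]].
  have inb (y : ext) : (forall i j, ball (xb i j) e (y i j)) -> bar_cone K y.
    by move=> h; apply: sub; split.
  split.
    apply/nbhs_ballP; exists e => //= y [_ xy].
    suff : bar_cone K (col_mx y (dsubmx xb)) by case; rewrite col_mxKu.
    apply: inb => i j; rewrite -[i]fintype.splitK.
    case: (fintype.split i) => [k|k] /=; rewrite ?col_mxEu ?col_mxEd.
      by have := xy k j; rewrite mxE.
    by rewrite mxE; exact: ballxx.
  suff : bar_cone K (col_mx (usubmx xb) (dsubmx xb - const_mx (e / 2))).
    case=> _; rewrite col_mxKd !mxE subr_ge0; apply: lt_le_trans.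
    by rewrite divr_gt0.
  apply: inb => i j; rewrite -[i]fintype.splitK.
  case: (fintype.split i) => [k|k] /=; rewrite ?col_mxEu ?col_mxEd !mxE.
    exact: ballxx.
  rewrite /ball /= opprD opprK addrA subrr add0r gtr0_norm ?divr_gt0 //.
  by rewrite ltr_pdivrMr // ltr_pMr // ltr1n.
have h1 : nbhs xb [set y : ext | K (usubmx y)] by apply: continuous_usubmx; exact: Kx.
have h2 := near_tau_gt0 t0.
apply: filterS2 h1 h2 => y /= Ky ty.
by split=> //; exact: ltW.
Qed.

Lemma feas_interior K (z : ext * 'cV[R]_m * ext) : (feas_region K)° z <->
  (bar_cone K)° (xbar z) /\ (bar_cone (dual_cone K))° (sbar z).
Proof.
case: z => [[x y] s]; rewrite /xbar /sbar /=; split.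
  case=> [[P Q] /= [[[P1 P2] /= [nP1 nP2] sP] nQ] sub]; split.
    apply: filterS nP1 => x' Px'.
    have [] // := sub ((x', y), s); split => //=; last exact: nbhs_singleton.
    by apply: sP; split => //=; exact: nbhs_singleton.
  apply: filterS nQ => s' Qs'.
  have [] // := sub ((x, y), s'); split => //=.
  by apply: sP; split; exact: nbhs_singleton.
move=> [hx hs]; exists ([set p | bar_cone K p.1], bar_cone (dual_cone K)) => /=.
  split=> //; exists (bar_cone K, setT) => /=; last by case=> a b [].
  by split=> //; exact: filterT.
by case=> [[a b] d] [].
Qed.

Lemma proper_cone_add K x y : proper_cone K -> K x -> K y -> K (x + y).
Proof.
move=> hK Kx Ky.
have h0 : (0 : R) <= 2^-1 by rewrite invr_ge0.
have h1 : 2^-1 <= 1 :> R by rewrite invf_le1 // ler1n.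
have := @pcone_convex _ _ _ hK x y (Itv01 h0 h1).
rewrite !inE => /(_ Kx Ky) /(pcone_scale hK (ler0n R 2)).
congr (K _); rewrite /conv /= scalerDr !scalerA /unstable.onem.
have -> : 2 * (1 - 2^-1) = 1 :> R by field.
by rewrite mulfV ?pnatr_eq0 // !scale1r.
Qed.

Lemma proper_cone0 K : proper_cone K -> K 0.
Proof.
move=> hK; have [x /interior_subset Kx] := pcone_full hK.
by rewrite -(scale0r x); exact: (pcone_scale hK).
Qed.

Lemma interior_add K (x u : 'cV[R]_n) : proper_cone K -> K° x -> K u -> K° (x + u).
Proof.
move=> hK /nbhs_ballP[e /= e0 sub] Ku; apply/nbhs_ballP; exists e => //= y xy.
rewrite -(subrK u y); apply: proper_cone_add => //; apply: sub.
by move: xy; rewrite -!ball_normE /= opprB addrA.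
Qed.

Lemma ext_dom_ray K (xb u : ext) t : proper_cone K ->
  ext_dom K° xb -> bar_cone K u -> 0 <= t -> ext_dom K° (xb + t *: u).
Proof.
move=> hK [Kx t0] [Ku u0] h; split.
  rewrite linearD linearZ /=; apply: interior_add => //.
  exact: (pcone_scale hK).
have -> : tau (xb + t *: u) = tau xb + t * tau u by rewrite !mxE.
by rewrite ltr_pwDl // mulr_ge0.
Qed.

Lemma bar_dual_ge0 K (x s : ext) : bar_cone K x -> bar_cone (dual_cone K) s ->
  0 <= dotv x s.
Proof.
by move=> [Kx x0] [Ks s0]; rewrite dotv_ext addr_ge0 ?mulr_ge0 //; exact: Ks.
Qed.

(** Testing with [(x; 0)] and [(0; 1)] shows that the dual of the extended cone
    is contained in the extension of the dual cone. *)
Lemma bar_dualP K (s : ext) : proper_cone K ->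
  (forall u, bar_cone K u -> 0 <= dotv u s) -> bar_cone (dual_cone K) s.
Proof.
move=> hK h; split=> [x Kx|].
  have := h (col_mx x 0); rewrite dotv_ext col_mxKu col_mxKd mxE mul0r addr0.
  by apply; split; rewrite ?col_mxKu ?col_mxKd ?mxE.
have := h (col_mx 0 (const_mx 1)); rewrite dotv_ext col_mxKu col_mxKd mxE mul1r.
rewrite /dotv trmx0 mul0mx mxE add0r; apply; split.
  by rewrite col_mxKu; exact: proper_cone0.
by rewrite col_mxKd mxE ler01.
Qed.

(** An interior point [s] of the dual cone remains in it after subtracting a
    small multiple of [x]. *)
Lemma dotv_interior_gt0 K (x s : ext) : x != 0 -> bar_cone K x ->
  (bar_cone (dual_cone K))° s -> 0 < dotv x s.
Proof.
move=> x0 Kx Ks.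
have /nbhs_ballP[e /= e0 sub] := near_line (- x) Ks.
have : ball (0 : R) e (e / 2).
  by rewrite /ball /= sub0r normrN gtr0_norm ?divr_gt0 // ltr_pdivrMr // ltr_pMr // ltr1n.
move=> /sub /(bar_dual_ge0 Kx).
rewrite scalerN dotvDr dotvNr dotvZr subr_ge0; apply: lt_le_trans.
rewrite mulr_gt0 ?divr_gt0 // lt_neqAle dotv_ge0 andbT eq_sym.
by apply: contra x0 => /eqP/dotv_eq0 ->.
Qed.

End Cones.

(** The coordinates of [v] are bounded by a multiple of its local norm, so that a
    small perturbation in sup norm is small in dual norm. *)
Lemma near_dual_le (R : realType) (k : nat) (M : 'M[R]_k) (s : 'cV[R]_k) (e : R) :
  has_root M -> 0 < e ->
  \forall y \near s, forall v, dotv (y - s) v <= e * hnorm M v.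
Proof.
move=> [S [pS <-]] e0.
pose C i := enorm (invmx S *m delta_mx i 0).
have C0 i : 0 <= C i := enorm_ge0 _.
have coordE (v : 'cV[R]_k) i : v i 0 = dotv (delta_mx i 0) v.
  rewrite dotvE (bigD1 i) //= big1 ?addr0 ?mxE ?eqxx ?mul1r // => j ji.
  by rewrite mxE (negbTE ji) mul0r.
have coord_le (v : 'cV[R]_k) i : `|v i 0| <= C i * hnorm (S *m S) v.
  have h w := (root_dual_le (delta_mx i 0) pS (C0 i)).2 (lexx _) w.
  rewrite coordE; apply/ler_normlP; split; last exact: h.
  by rewrite -dotvNr -[X in _ * X]hnormN; exact: h.
pose T := \sum_i C i.
have T0 : 0 <= T by rewrite sumr_ge0.
have T1 : 0 < T + 1 by rewrite ltr_wpDl.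
have d0 : 0 < e / (T + 1) by rewrite divr_gt0.
apply/nbhs_ballP; exists (e / (T + 1)) => //= y [_ sy] v.
have n0 := hnorm_ge0 (S *m S) v.
apply: le_trans (_ : \sum_i (e / (T + 1)) * (C i * hnorm (S *m S) v) <= _).
  rewrite dotvE ler_sum // => i _; apply: le_trans (ler_norm _) _.
  rewrite normrM ler_pM // !mxE distrC ltW //.
  by have := sy i 0.
rewrite -mulr_sumr -mulr_suml mulrA ler_wpM2r // mulrAC ler_pdivrMr //.
by rewrite ler_wpM2l ?ltW // ltrDl ltr01.
Qed.

(** * The homogeneous self-dual system *)

Section SelfDual.
Variables (R : realType) (n m : nat).
Variables (A : 'M[R]_(m, n)) (b : 'cV[R]_m) (c : 'cV[R]_n).

Lemma dotv_col_mx (p q : nat) (u1 v1 : 'cV[R]_p) (u2 v2 : 'cV[R]_q) :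
  dotv (col_mx u1 u2) (col_mx v1 v2) = dotv u1 v1 + dotv u2 v2.
Proof. by rewrite /dotv tr_col_mx mul_row_col mxE. Qed.

Lemma Gmx_skew : (Gmx A b c)^T = - Gmx A b c.
Proof.
rewrite /Gmx tr_block_mx tr_row_mx tr_col_mx tr_block_mx opp_block_mx.
rewrite opp_row_mx opp_col_mx opp_block_mx !linearN /= !trmxK !trmx0 !opprK !oppr0.
by [].
Qed.

(** The skew-symmetric quadratic form of [G] vanishes. *)
Lemma residual_orth z : residual A b c z = 0 -> dotv (xbar z) (sbar z) = 0.
Proof.
rewrite /residual => /eqP; rewrite subr_eq0 => /eqP e.
set u := col_mx _ _ in e.
have : dotv u (Gmx A b c *m u) = 0.
  have : dotv u (Gmx A b c *m u) = - dotv u (Gmx A b c *m u).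
    by rewrite {1}dotvC dotv_mulmx Gmx_skew mulNmx dotvNr.
  by lra.
by rewrite e dotv_col_mx /dotv mulmx0 mxE add0r.
Qed.

Lemma residualD z D : residual A b c (z + D) = residual A b c z + residual A b c D.
Proof.
rewrite /residual /yvec /xbar /sbar /= -add_col_mx mulmxDr.
have -> : col_mx 0 (z.2 + D.2) = col_mx 0 z.2 + col_mx 0 D.2 :> 'cV[R]_(m + (n + 1)).
  by rewrite add_col_mx add0r.
by rewrite opprD addrACA.
Qed.

End SelfDual.

(** * The predictor phase *)

(** The relative residual [1/5] obtained at the new point leaves room below the
    bound [1/4] of [dual_ray_ge0]; the difference [1/20] is spent on a
    neighbourhood of the new dual point, which makes this point interior. *)
Lemma predictor_nbhd (R : realType) (n m : nat) (n_gt0 : (0 < n)%N)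
  (K : set 'cV[R]_n) (hK : proper_cone K)
  (A : 'M[R]_(m, n)) (b : 'cV[R]_m) (c : 'cV[R]_n)
  (F : 'cV[R]_n -> R) (nu : R) (hF : lh_barrier K F nu) (eta beta alpha a : R)
  (z Delta : 'cV[R]_(n + 1) * 'cV[R]_m * 'cV[R]_(n + 1)) :
  0 <= eta -> a < 1 -> a * eta < 1 -> 5^-1 <= beta ->
  (eta + a / (1 - a) ^+ 2 + a / (1 - a)) / (1 - a) + a * eta
    <= 5^-1 * (1 - a * eta) ->
  0 <= alpha -> alpha * Num.sqrt (nubar nu) <= a ->
  nbhd K F nu eta z -> predictor_system A b c F nu z Delta ->
  nbhd K F nu beta (z + alpha *: Delta).
Proof.
move=> eta0 a1 ae b5 hnum al0 als [zint zle] [res pre].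
have bgF := barrier_geometry_lhb n_gt0 hF; have bg := barrier_geometry_ext bgF.
have [xi si] := (feas_interior _ _).1 zint.
have Dx := (bar_cone_interior _ _).1 xi; case: (Dx) => Kx t0.
have nu0 : 0 <= nu := param_ge0 bgF Kx.
have nb1 : 1 <= nubar nu by rewrite /nubar lerDr.
have nbp : 0 < nubar nu := lt_le_trans ltr01 nb1.
have mu0 : 0 < mu nu z.
  rewrite divr_gt0 //; apply: (dotv_interior_gt0 _ (interior_subset xi) si).
  by apply: contraTneq t0 => ->; rewrite !mxE ltxx.
have rx := bg_root bg Dx.
have xs : dotv (xbar z) (sbar z) = nubar nu * mu nu z.
  by rewrite /mu mulrC divfK // gt_eqF.
have psile v : dotv (sbar z + mu nu z *: ext_grad (grad F) (xbar z)) v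
    <= eta * mu nu z * hnorm (ext_hess (hess F) (xbar z)) v.
  have em0 : 0 <= eta * mu nu z by rewrite mulr_ge0 // ltW.
  have hr : has_root (hess (bar_fun F) (xbar z)) by rewrite bar_hessE.
  have := (dual_lnorm_le _ hr em0).1 zle v.
  by rewrite /psiz /psi bar_gradE // bar_hessE.
move: pre; rewrite bar_hessE // => pre.
have orth : dotv (xbar z + xbar Delta) (sbar z + sbar Delta) = 0.
  by apply: (@residual_orth _ _ _ A b c (z + Delta)); rewrite residualD res subrr.
have := predictor_step bg Dx mu0 nb1 xs eta0 psile pre orth al0 als a1 ae hnum.
move=> /=.
set z' := z + alpha *: Delta.
rewrite -[_ + alpha *: xbar _]/(xbar z').
rewrite -[_ + alpha *: sbar _]/(sbar z').
rewrite -/(mu nu z') => -[Dx' mu'0 hle].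
have rx' := bg_root bg Dx'; case: (Dx') => _ t0'.
split; last first.
  have b0 : 0 <= beta by rewrite (le_trans _ b5) // invr_ge0.
  have hr : has_root (hess (bar_fun F) (xbar z')) by rewrite bar_hessE.
  have bm0 : 0 <= beta * mu nu z' by rewrite mulr_ge0 // ltW.
  apply/(dual_lnorm_le _ hr bm0) => v.
  rewrite /psiz /psi bar_gradE // bar_hessE //; apply: le_trans (hle v) _.
  by rewrite ler_wpM2r ?hnorm_ge0 // ler_wpM2r // ltW.
apply/feas_interior; split; first exact/bar_cone_interior.
have e0 : 0 < mu nu z' / 20 by rewrite divr_gt0.
have := near_dual_le (sbar z') rx' e0.
apply: filterS => s' hs'; apply: bar_dualP => // u Ku.
apply: (dual_ray_ge0 bg Dx' mu'0 (lexx (mu nu z' / 4))) => [v|t]; last first.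
  exact: ext_dom_ray.
have -> : s' + mu nu z' *: ext_grad (grad F) (xbar z') =
    (s' - sbar z') + (sbar z' + mu nu z' *: ext_grad (grad F) (xbar z')).
  by rewrite addrA subrK.
rewrite dotvDl; apply: le_trans (lerD (hs' v) (hle v)) _.
rewrite -mulrDl ler_wpM2r ?hnorm_ge0 //; lra.
Qed.

Theorem lemma9 (R : realType) (n m : nat) (n_gt0 : (0 < n)%N)
  (K : set 'cV[R]_n) (hK : proper_cone K)
  (A : 'M[R]_(m, n)) (hA : row_free A) (b : 'cV[R]_m) (c : 'cV[R]_n)
  (F : 'cV[R]_n -> R) (nu : R) (hF : lh_barrier K F nu)
  (eta beta eps alpha_p k_xbar : R) (r_c : nat) (r_c_gt0 : (0 < r_c)%N)
  (hk : k_xbar = eta + Num.sqrt (2 * eta ^+ 2 + nubar nu))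
  (hparam :
     [/\ beta = 20 / 100, eps = 50 / 100, r_c = 1%N,
         eta = beta * eps ^+ r_c & alpha_p = 20 / 1000 * k_xbar^-1]
  \/ [/\ beta = 25 / 100, eps = 70 / 100, r_c = 2%N,
         eta = beta * eps ^+ r_c & alpha_p = 25 / 1000 * k_xbar^-1])
  (z : 'cV[R]_(n + 1) * 'cV[R]_m * 'cV[R]_(n + 1))
  (hz : nbhd K F nu eta z)
  (Delta : 'cV[R]_(n + 1) * 'cV[R]_m * 'cV[R]_(n + 1))
  (hDelta : predictor_system A b c F nu z Delta) :
  nbhd K F nu beta (z + alpha_p *: Delta).
Proof.
have nb0 : 0 < nubar nu.
  have [/feas_interior [/bar_cone_interior [Kx _] _] _] := hz.
  by rewrite ltr_wpDl // (param_ge0 (barrier_geometry_lhb n_gt0 hF) Kx).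
have step (a : R) : 0 <= a -> 0 <= eta -> alpha_p = a * k_xbar^-1 ->
    0 <= alpha_p /\ alpha_p * Num.sqrt (nubar nu) <= a.
  move=> a0 eta0 ->.
  have sk : Num.sqrt (nubar nu) <= k_xbar.
    by rewrite hk ler_wpDl // ler_wsqrtr // lerDr mulr_ge0 // sqr_ge0.
  have k0 : 0 < k_xbar by apply: lt_le_trans sk; rewrite sqrtr_gt0.
  split; first by rewrite mulr_ge0 // invr_ge0 ltW.
  by rewrite -mulrA ler_piMr // ler_pdivrMl // mulr1.
case: hparam => -[hb he hr heta hal].
- have etaE : eta = 1 / 10 by rewrite heta hb he hr; field.
  have eta0 : 0 <= eta by rewrite etaE; lra.
  have a0 : 0 <= 20 / 1000 :> R by lra.
  have [al0 als] := step _ a0 eta0 hal.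
  have iE : (1 - 20 / 1000 : R)^-1 = 50 / 49 by field.
  apply: (predictor_nbhd n_gt0 hK hF eta0 _ _ _ _ al0 als hz hDelta);
    [lra | rewrite etaE; lra | rewrite hb; lra |].
  by rewrite -exprVn iE etaE; lra.
- have etaE : eta = 49 / 400 by rewrite heta hb he hr; field.
  have eta0 : 0 <= eta by rewrite etaE; lra.
  have a0 : 0 <= 25 / 1000 :> R by lra.
  have [al0 als] := step _ a0 eta0 hal.
  have iE : (1 - 25 / 1000 : R)^-1 = 40 / 39 by field.
  apply: (predictor_nbhd n_gt0 hK hF eta0 _ _ _ _ al0 als hz hDelta);
    [lra | rewrite etaE; lra | rewrite hb; lra |].
  by rewrite -exprVn iE etaE; lra.
Qed.
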